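(* Fix $\alpha,\beta>0$. For $n\ge2$ let $S$ be a random $\alpha/\beta$-staircase tableau of size $n$ with law $\mathbb{P}_{n,\alpha,\beta}$, and let $A_n$ be the number of boxes $(n-j,j)$, $1\le j\le n-1$ (the second main diagonal), that contain $\alpha$. Then, as $n\to\infty$, $A_n$ converges in distribution to a Poisson random variable with parameter $1/2$.
   Context: A staircase tableau of size $n$ has boxes $(i,j)$ with $i,j\ge1$ and $i+j\le n+1$, rows numbered from the top and columns from the left. An $\alpha/\beta$-staircase tableau of size $n$ is a filling in which each box is empty or contains $\alpha$ or $\beta$, such that: all boxes in the same column and above an $\alpha$ are empty; all boxes in the same row and to the left of a $\beta$ are empty; every main-diagonal box (with $i+j=n+1$) contains a symbol. $\overline{\mathcal{S}}_n$ is the set of these. The weight is $wt(S)=\alpha^{N_\alpha}\beta^{N_\beta}$ ($N_\alpha,N_\beta$ the numbers of $\alpha$'s, $\beta$'s), and $\mathbb{P}_{n,\alpha,\beta}(S)=wt(S)/\sum_{T\in\overline{\mathcal{S}}_n}wt(T)$. *)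

(* Defs.v *)
From HB Require Import structures.
From mathcomp Require Import all_boot all_order all_algebra.
From mathcomp Require Import boolp classical_sets reals topology normedtype sequences exp.
From mathcomp Require Import poisson_distribution.
Set Implicit Arguments. Unset Strict Implicit. Unset Printing Implicit Defensive.
Import Order.TTheory GRing.Theory Num.Theory.
Local Open Scope ring_scope.

(* Boxes are indexed 0-based: box (i,j) : 'I_n * 'I_n corresponds to the
   paper's box (i+1, j+1).  The staircase of size n is i + j <= n - 1 (0-based),
   i.e. i+j <= n+1 in 1-based coordinates.  A filling assigns to each box
   None (empty), Some true (alpha) or Some false (beta). *)
Definition filling (n : nat) := {ffun 'I_n * 'I_n -> option bool}.

Definition in_stair (n : nat) (b : 'I_n * 'I_n) : bool := (b.1 + b.2 < n)%N.

(* main diagonal: paper's i + j = n + 1, i.e. 0-based i + j + 1 = n *)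
Definition on_main_diag (n : nat) (b : 'I_n * 'I_n) : bool := (b.1 + b.2).+1 == n.

(* second main diagonal: paper's boxes (n-j, j), 1 <= j <= n-1, i.e. i + j = n,
   i.e. 0-based i + j + 2 = n *)
Definition on_second_diag (n : nat) (b : 'I_n * 'I_n) : bool := (b.1 + b.2).+2 == n.

Definition is_ab_staircase (n : nat) (S : filling n) : bool :=
  [&& [forall b, ~~ in_stair b ==> (S b == None)],
      [forall b, (S b == Some true) ==>
         [forall b' : 'I_n * 'I_n, ((b'.2 == b.2) && (b'.1 < b.1)%N) ==> (S b' == None)]],
      [forall b, (S b == Some false) ==>
         [forall b' : 'I_n * 'I_n, ((b'.1 == b.1) && (b'.2 < b.2)%N) ==> (S b' == None)]]
    &
      [forall b, on_main_diag b ==> (S b != None)]].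

Definition N_alpha (n : nat) (S : filling n) : nat := #|[set b | S b == Some true]|.
Definition N_beta (n : nat) (S : filling n) : nat := #|[set b | S b == Some false]|.

Definition wt {R : realType} (alpha beta : R) (n : nat) (S : filling n) : R :=
  alpha ^+ N_alpha S * beta ^+ N_beta S.

Definition A_stat (n : nat) (S : filling n) : nat :=
  #|[set b | on_second_diag b && (S b == Some true)]|.

Definition prob_A_eq {R : realType} (alpha beta : R) (n k : nat) : R :=
  (\sum_(S : filling n | is_ab_staircase S && (A_stat S == k)) wt alpha beta S) /
  (\sum_(S : filling n | is_ab_staircase S) wt alpha beta S).

(* Main.v *)
Require Import Defs.
From HB Require Import structures.
From mathcomp Require Import all_boot all_order all_algebra.
From mathcomp Require Import ring lra zify.
From mathcomp Require Import boolp classical_sets reals topology normedtype sequences exp.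
From mathcomp Require Import poisson_distribution.
Set Implicit Arguments. Unset Strict Implicit. Unset Printing Implicit Defensive.
Import Order.TTheory GRing.Theory Num.Theory.
Import numFieldTopology.Exports numFieldNormedType.Exports.
Local Open Scope classical_set_scope.
Local Open Scope ring_scope.

(* Removing the first column of a tableau of size n leaves a tableau of size n - 1, and
   symbols can be put into that column only in rows without beta.  Marking these rows by
   a variable x, let G(n,k,x) be the sum of wt(S) x^(number of rows without beta) C(A(S),k).
   Summing over the first column gives
     G(n,k,x) = (a x + b) G(n-1,k,x+b) + a^2 b x G(n-2,k-1,x),
   so that G(n,0,x) is the product of the a x + b + i a b for i < n, and for k > 0 the
   recursion pins G(n,k,1) / G(n,0,1) between two quantities tending to (1/2)^k / k!.
   Hence all binomial moments of A_n converge to those of the Poisson law, and the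
   Bonferroni inequalities turn this into convergence of the point probabilities. *)

(** * Adding a column on the left of a tableau *)

Definition column (n : nat) := {ffun 'I_n -> option bool}.

(** Columns grow at the bottom: an alpha there empties every box above it, while a beta or an empty
    box imposes nothing on them. *)
Definition ext_col n (c : column n) (v : option bool) : column n.+1 :=
  [ffun i => if unlift ord_max i is Some i' then c i' else v].

(* The new column is column 0.  The rows of [T] keep their indices, and the new row
   [ord_max] has its only staircase box in column 0. *)
Definition ext_filling n (T : filling n) (c : column n.+1) : filling n.+1 :=
  [ffun b => if unlift ord0 b.2 is Some j
             then if unlift ord_max b.1 is Some i then T (i, j) else None
             else c b.1].

(** In the uses below [v] is [true]: the new bottom row meets the old tableau in no box, so it has
    no beta yet. *)
Definition ext_pred n (f : pred 'I_n) (v : bool) : pred 'I_n.+1 :=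
  fun i => if unlift ord_max i is Some i' then f i' else v.

Lemma ext_colE n (c : column n) v i : ext_col c v (lift ord_max i) = c i.
Proof. by rewrite ffunE liftK. Qed.

Lemma ext_col_max n (c : column n) v : ext_col c v ord_max = v.
Proof. by rewrite ffunE unlift_none. Qed.

Lemma ext_filling0 n (T : filling n) c i : ext_filling T c (i, ord0) = c i.
Proof. by rewrite ffunE /= unlift_none. Qed.

Lemma ext_filling_lift n (T : filling n) c i j :
  ext_filling T c (lift ord_max i, lift ord0 j) = T (i, j).
Proof. by rewrite ffunE /= !liftK. Qed.

Lemma ext_filling_max n (T : filling n) c j :
  ext_filling T c (ord_max, lift ord0 j) = None.
Proof. by rewrite ffunE /= liftK unlift_none. Qed.

Lemma big_ord_recr_lift (V : Type) (idx : V) (op : Monoid.law idx) n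
    (F : 'I_n.+1 -> V) :
  \big[op/idx]_(i < n.+1) F i =
  op (\big[op/idx]_(i < n) F (lift ord_max i)) (F ord_max).
Proof.
rewrite big_ord_recr; congr (op _ _); apply: eq_bigr => i _; congr F.
by apply: val_inj; rewrite /= /bump leqNgt ltn_ord.
Qed.

Lemma sum_option_bool (V : nmodType) (P : pred (option bool)) (F : option bool -> V) :
  \sum_(v | P v) F v = (if P None then F None else 0) +
    (if P (Some true) then F (Some true) else 0) +
    (if P (Some false) then F (Some false) else 0).
Proof.
rewrite big_mkcond /= (bigD1 None) //= (bigD1 (Some true)) //= (bigD1 (Some false)) //=.
by rewrite big1 ?addr0 ?addrA // => -[[|]|].
Qed.

Lemma sum_column (V : nmodType) n (P : pred (column n.+1)) (F : column n.+1 -> V) :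
  \sum_(c | P c) F c =
  \sum_c \sum_(v | P (ext_col c v)) F (ext_col c v).
Proof.
pose cut (c : column n.+1) : column n * option bool :=
  ([ffun i => c (lift ord_max i)], c ord_max).
rewrite (reindex_onto (fun p => ext_col p.1 p.2) cut) /=.
  rewrite pair_big_dep /=; apply: eq_bigl => -[c v] /=.
  rewrite andbC; case: eqP => // -[]; rewrite /cut ext_col_max; congr pair.
  by apply/ffunP => i; rewrite ffunE ext_colE.
move=> c _; apply/ffunP => i; case: (unliftP ord_max i) => [i'|] ->.
  by rewrite ext_colE ffunE.
by rewrite ext_col_max.
Qed.

(** * Validity of the enlarged tableau *)

Definition row_free n (S : filling n) : pred 'I_n :=
  fun i => [forall j, S (i, j) != Some false].

(* Validity of a column added on the left of rows among which [f] selects those without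
   beta: only these may receive a symbol. *)
Definition col_ok n (f : pred 'I_n) (c : column n) : bool :=
  [forall i, (c i != None) ==> f i] &&
  [forall i, (c i == Some true) ==> [forall i' : 'I_n, (i' < i)%N ==> (c i' == None)]].

Lemma staircaseP n (S : filling n) :
  reflect [/\ forall b, ~~ in_stair b -> S b = None,
    forall (i i' j : 'I_n), S (i, j) = Some true -> (i' < i)%N -> S (i', j) = None,
    forall (i j j' : 'I_n), S (i, j) = Some false -> (j' < j)%N -> S (i, j') = None
    & forall b, on_main_diag b -> S b <> None] (is_ab_staircase S).
Proof.
apply: (iffP and4P) => -[h1 h2 h3 h4]; split.
- by move=> b hb; move/forallP/(_ b)/implyP/(_ hb)/eqP: h1.
- move=> i i' j hS lt; move/forallP/(_ (i, j))/implyP: h2.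
  by rewrite hS => /(_ isT)/forallP/(_ (i', j))/implyP; rewrite /= eqxx lt => /(_ isT)/eqP.
- move=> i j j' hS lt; move/forallP/(_ (i, j))/implyP: h3.
  by rewrite hS => /(_ isT)/forallP/(_ (i, j'))/implyP; rewrite /= eqxx lt => /(_ isT)/eqP.
- by move=> b hb; move/forallP/(_ b)/implyP/(_ hb)/eqP: h4.
- by apply/forallP => b; apply/implyP => /h1/eqP.
- apply/forallP => -[i j]; apply/implyP => /eqP hS; apply/forallP => -[i' j'].
  by apply/implyP => /= /andP[/eqP-> lt]; apply/eqP/(h2 _ _ _ hS lt).
- apply/forallP => -[i j]; apply/implyP => /eqP hS; apply/forallP => -[i' j'].
  by apply/implyP => /= /andP[/eqP-> lt]; apply/eqP/(h3 _ _ _ hS lt).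
- by apply/forallP => b; apply/implyP => /h4/eqP.
Qed.

Lemma col_okP n (f : pred 'I_n) (c : column n) :
  reflect [/\ forall i, c i <> None -> f i
    & forall i i' : 'I_n, c i = Some true -> (i' < i)%N -> c i' = None] (col_ok f c).
Proof.
apply: (iffP andP) => -[h1 h2]; split.
- by move=> i /eqP hi; move/forallP/(_ i)/implyP/(_ hi): h1.
- move=> i i' hi lt; move/forallP/(_ i)/implyP: h2.
  by rewrite hi => /(_ isT)/forallP/(_ i')/implyP/(_ lt)/eqP.
- by apply/forallP => i; apply/implyP => /eqP/h1.
- apply/forallP => i; apply/implyP => /eqP hi; apply/forallP => i'.
  by apply/implyP => lt; apply/eqP/(h2 _ _ hi lt).
Qed.

(** Columns shift by one as the size grows by one, so old diagonal boxes stay diagonal and the only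
    new one is the bottom of the new column. The beta rule affects the new column exactly in the
    rows that already hold a beta. *)
Lemma is_ab_staircase_ext n (T : filling n) (c : column n.+1) :
  is_ab_staircase (ext_filling T c) =
  [&& is_ab_staircase T, col_ok (ext_pred (row_free T) true) c & c ord_max != None].
Proof.
apply/staircaseP/and3P.
  move=> [h1 h2 h3 h4]; split.
  - apply/staircaseP; split.
    + move=> [i j] hb; rewrite -(ext_filling_lift T c); apply: h1.
      by move: hb; rewrite /in_stair /= /bump (leqNgt n) ltn_ord /=; lia.
    + move=> i i' j; rewrite -!(ext_filling_lift T c) => hS lt.
      by apply: (h2 _ _ _ hS); rewrite !lift_max.
    + move=> i j j'; rewrite -!(ext_filling_lift T c) => hS lt.
      by apply: (h3 _ _ _ hS); rewrite !lift0.
    + move=> [i j] hb; rewrite -(ext_filling_lift T c); apply: h4.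
      by move: hb; rewrite /on_main_diag /= /bump (leqNgt n) ltn_ord /=; lia.
  - apply/col_okP; split.
    + move=> i; rewrite /ext_pred; case: (unliftP ord_max i) => // i' -> hc.
      apply/forallP => j; apply/eqP; rewrite -(ext_filling_lift T c) => hS.
      by apply: hc; rewrite -(ext_filling0 T c); apply: (h3 _ _ _ hS); rewrite lift0.
    + by move=> i i'; rewrite -!(ext_filling0 T c); apply: h2.
  - by apply/eqP; rewrite -(ext_filling0 T c); apply: h4; rewrite /on_main_diag /= addn0.
move=> [/staircaseP[h1 h2 h3 h4] /col_okP[k1 k2] hm]; split.
- move=> [i j]; case: (unliftP ord0 j) => [j'|] ->; last first.
    by rewrite /in_stair /= addn0 ltn_ord.
  case: (unliftP ord_max i) => [i'|] ->; last by rewrite ext_filling_max.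
  rewrite ext_filling_lift => hb; apply: h1.
  by move: hb; rewrite /in_stair /= /bump (leqNgt n) ltn_ord /=; lia.
- move=> i i' j; case: (unliftP ord0 j) => [j'|] ->; last by rewrite !ext_filling0; apply: k2.
  case: (unliftP ord_max i) => [i1|] ->; last by rewrite ext_filling_max.
  case: (unliftP ord_max i') => [i1'|] ->; last by rewrite ext_filling_max.
  by rewrite !ext_filling_lift !lift_max; apply: h2.
- move=> i j j'; case: (unliftP ord0 j) => [j1|] -> //.
  case: (unliftP ord_max i) => [i1|] ->; last by rewrite ext_filling_max.
  rewrite ext_filling_lift => hS.
  case: (unliftP ord0 j') => [j1'|] ->.
    by rewrite ext_filling_lift !lift0 ltnS; apply: h3.
  rewrite ext_filling0 => _; case E: (c _) => [v|] //.
  have /forallP/(_ j1) : row_free T i1.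
    by have := k1 (lift ord_max i1); rewrite E /ext_pred liftK => h; apply: h.
  by rewrite hS.
- move=> [i j]; case: (unliftP ord0 j) => [j'|] ->; last first.
    rewrite /on_main_diag ext_filling0 /= addn0 eqSS => /eqP hi.
    suff -> : i = ord_max by apply/eqP.
    exact: val_inj.
  case: (unliftP ord_max i) => [i'|] ->.
    rewrite ext_filling_lift => hb; apply: h4.
    by move: hb; rewrite /on_main_diag /= /bump (leqNgt n) ltn_ord /=; lia.
  by rewrite /on_main_diag /= /bump /=; lia.
Qed.

Lemma sum_staircase (V : nmodType) n (F : filling n.+1 -> V) :
  \sum_(S | is_ab_staircase S) F S =
  \sum_(T : filling n | is_ab_staircase T)
    \sum_(c | col_ok (ext_pred (row_free T) true) c && (c ord_max != None))
       F (ext_filling T c).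
Proof.
pose cut (S : filling n.+1) : filling n * column n.+1 :=
  ([ffun b => S (lift ord_max b.1, lift ord0 b.2)], [ffun i => S (i, ord0)]).
rewrite (reindex_onto (fun p => ext_filling p.1 p.2) cut) /=.
  rewrite pair_big_dep /=; apply: eq_bigl => -[T c] /=.
  rewrite is_ab_staircase_ext; case: (cut _ =P _); rewrite ?andbT // => -[].
  rewrite /cut /=; congr pair.
    by apply/ffunP => -[i j]; rewrite ffunE ext_filling_lift.
  by apply/ffunP => i; rewrite ffunE ext_filling0.
(* [cut] forgets the bottom row to the right of column 0; these boxes lie outside the staircase,
   hence are empty. *)
move=> S /staircaseP[h1 _ _ _]; apply/ffunP => -[i j].
case: (unliftP ord0 j) => [j'|] ->; last by rewrite ext_filling0 ffunE.
case: (unliftP ord_max i) => [i'|] ->; first by rewrite ext_filling_lift ffunE.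
rewrite ext_filling_max h1 // /in_stair /= /bump /=; lia.
Qed.

Lemma col_ok_ext n (f : pred 'I_n.+1) (c : column n) v :
  col_ok f (ext_col c v) =
  match v with
  | None => col_ok (fun i => f (lift ord_max i)) c
  | Some true => f ord_max && (c == [ffun => None])
  | Some false => f ord_max && col_ok (fun i => f (lift ord_max i)) c
  end.
Proof.
have sub : col_ok f (ext_col c v) -> col_ok (fun i => f (lift ord_max i)) c.
  move=> /col_okP[h1 h2]; apply/col_okP; split=> [i|i i'].
    by rewrite -(ext_colE c v); apply: h1.
  by rewrite -!(ext_colE c v) => hc lt; apply: (h2 _ _ hc); rewrite !lift_max.
have ext (w : option bool) : w <> Some true -> (w <> None -> f ord_max) ->
    col_ok (fun i => f (lift ord_max i)) c -> col_ok f (ext_col c w).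
  move=> hw hf /col_okP[h1 h2]; apply/col_okP; split=> [i|i i'].
    by case: (unliftP ord_max i) => [i1|] ->; rewrite ?ext_colE ?ext_col_max; [apply: h1 | apply: hf].
  case: (unliftP ord_max i) => [i1|] ->; rewrite ?ext_colE ?ext_col_max; last by move/hw.
  case: (unliftP ord_max i') => [i1'|] ->; rewrite ?ext_colE ?ext_col_max.
    by rewrite !lift_max; apply: h2.
  by rewrite lift_max /= ltnNge (ltnW (ltn_ord i1)).
case: v sub => [[|]|] sub; apply/idP/idP => //.
- move=> /col_okP[h1 h2]; rewrite h1 ?ext_col_max //=; apply/eqP/ffunP => i.
  rewrite ffunE -(ext_colE c (Some true)); apply: (h2 ord_max).
    by rewrite ext_col_max.
  by rewrite lift_max.
- move=> /andP[hf /eqP->]; apply/col_okP; split=> [i|i i'].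
    by case: (unliftP ord_max i) => [i1|] ->; rewrite ?ext_colE ?ffunE.
  case: (unliftP ord_max i) => [i1|] ->; first by rewrite ext_colE ffunE.
  case: (unliftP ord_max i') => [i1'|] ->; last by rewrite ltnn.
  by rewrite ext_col_max ext_colE ffunE.
- by move=> h; rewrite sub //; case/col_okP: h => h1 _; rewrite h1 // ext_col_max.
- by move=> /andP[hf ok]; apply: ext.
- by apply: ext.
Qed.

(** * Weights and statistics under column insertion *)

Definition symbol_wt (R : nzRingType) (a b : R) (v : option bool) : R :=
  match v with None => 1 | Some true => a | Some false => b end.

Definition free_wt (R : nzRingType) (x : R) (f : bool) : R := if f then x else 1.

Definition col_wt (R : comNzRingType) (a b x : R) n (f : pred 'I_n) (c : column n) : R :=
  \prod_i (symbol_wt a b (c i) * free_wt x (f i && (c i != Some false))).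

(** Meant for a first column stripped of its diagonal box: its lowest box then lies on the second
    diagonal. *)
Definition last_alpha n : column n -> bool :=
  match n with 0 => fun=> false | n'.+1 => fun c => c ord_max == Some true end.

Definition free_row_wt (R : realType) (a b x : R) n (S : filling n) : R :=
  wt a b S * \prod_i free_wt x (row_free S i).

Lemma wtE (R : realType) (a b : R) n (S : filling n) :
  wt a b S = \prod_i \prod_j symbol_wt a b (S (i, j)).
Proof.
rewrite /wt /N_alpha /N_beta -!prodr_const big_mkcond [X in _ * X]big_mkcond.
rewrite -big_split pair_big /=; apply: eq_bigr => -[i j] _ /=; rewrite !inE.
by case: (S (i, j)) => [[]|] /=; rewrite ?mulr1 ?mul1r.
Qed.

Lemma A_statE n (S : filling n) :
  A_stat S = (\sum_i \sum_j (on_second_diag (i, j) && (S (i, j) == Some true)))%N.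
Proof.
rewrite /A_stat -sum1_card big_mkcond pair_big /=; apply: eq_bigr => -[i j] _.
by rewrite inE; case: ifP.
Qed.

(** The second diagonal of [T] stays on the second diagonal; the only possible new box is the one
    just above the bottom of the new column. *)
Lemma A_stat_ext n (T : filling n) (c : column n) v :
  A_stat (ext_filling T (ext_col c v)) = (A_stat T + last_alpha c)%N.
Proof.
rewrite !A_statE big_ord_recr_lift big_ord_recl /= ext_filling0.
rewrite [X in (_ + (_ + X))%N]big1; last first.
  by move=> j _; rewrite ext_filling_max andbF.
have -> : on_second_diag (@ord_max n, @ord0 n) = false.
  by rewrite /on_second_diag /= addn0 gtn_eqF.
rewrite !addn0.
under eq_bigr do rewrite big_ord_recl /= ext_filling0 ext_colE addnC.
rewrite big_split /=; congr (_ + _)%N.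
  apply: eq_bigr => i _; apply: eq_bigr => j _; rewrite ext_filling_lift.
  rewrite /on_second_diag /= /bump (leqNgt n) ltn_ord /=; congr (nat_of_bool (_ && _)).
  by apply/eqP/eqP; lia.
case: n T c => [|n] T c; first by rewrite big_ord0.
rewrite big_ord_recr_lift big1 /= => [|i _].
  by rewrite add0n /on_second_diag /= /bump ltnn /= addn0 eqxx.
have lti := ltn_ord i; rewrite /on_second_diag /= /bump (leqNgt n) lti /=.
by rewrite leqNgt ltnS ltnW //= addn0 !eqSS ltn_eqF.
Qed.

Lemma row_free_ext n (T : filling n) c i :
  row_free (ext_filling T c) i = ext_pred (row_free T) true i && (c i != Some false).
Proof.
rewrite /row_free /ext_pred; apply/forallP/andP => [h|[h1 h2] j].
  have := h ord0; rewrite ext_filling0; split=> //.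
  case: (unliftP ord_max i) h => // i' -> h; apply/forallP => j.
  by rewrite -(ext_filling_lift T c).
case: (unliftP ord0 j) => [j'|] ->; last by rewrite ext_filling0.
move: h1; case: (unliftP ord_max i) => [i'|] -> h1; last by rewrite ext_filling_max.
by rewrite ext_filling_lift (forallP h1).
Qed.

Lemma free_row_wt_ext (R : realType) (a b x : R) n (T : filling n) c :
  free_row_wt a b x (ext_filling T c) =
  wt a b T * col_wt a b x (ext_pred (row_free T) true) c.
Proof.
rewrite /free_row_wt /col_wt !wtE.
under eq_bigr do rewrite big_ord_recl ext_filling0.
rewrite big_split /= mulrC mulrA -big_split /= mulrC; congr (_ * _).
  rewrite big_ord_recr_lift /= [X in _ * X]big1 ?mulr1 => [|j _].
    by apply: eq_bigr => i _; apply: eq_bigr => j _; rewrite ext_filling_lift.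
  by rewrite ext_filling_max.
by apply: eq_bigr => i _; rewrite row_free_ext mulrC.
Qed.

Lemma eq_col_wt (R : comNzRingType) (a b x : R) n (f g : pred 'I_n) (c : column n) :
  f =1 g -> col_wt a b x f c = col_wt a b x g c.
Proof. by move=> fg; apply: eq_bigr => i _; rewrite fg. Qed.

Lemma eq_col_ok n (f g : pred 'I_n) (c : column n) : f =1 g -> col_ok f c = col_ok g c.
Proof. by move=> fg; rewrite /col_ok; congr (_ && _); apply: eq_forallb => i; rewrite fg. Qed.

Lemma col_wt_ext (R : comNzRingType) (a b x : R) n (f : pred 'I_n.+1) (c : column n) v :
  col_wt a b x f (ext_col c v) =
  col_wt a b x (fun i => f (lift ord_max i)) c *
    (symbol_wt a b v * free_wt x (f ord_max && (v != Some false))).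
Proof.
rewrite /col_wt big_ord_recr_lift ext_col_max; congr (_ * _).
by apply: eq_bigr => i _; rewrite ext_colE.
Qed.

Lemma col_wt_none (R : comNzRingType) (a b x : R) n (f : pred 'I_n) :
  col_wt a b x f [ffun=> None] = \prod_i free_wt x (f i).
Proof. by apply: eq_bigr => i _; rewrite ffunE mul1r andbT. Qed.

(** * Sums over one column *)

(** Case split on the bottom symbol. The alpha case is a single term, since all boxes above must be
    empty. *)
Lemma sum_col_ext (R : comNzRingType) (a b x : R) n (f : pred 'I_n.+1)
    (P : pred (option bool)) (F : column n.+1 -> R) :
  \sum_(c | col_ok f c && P (c ord_max)) col_wt a b x f c * F c =
  let g i := f (lift ord_max i) in
  (if P None then \sum_(c | col_ok g c) col_wt a b x g c * free_wt x (f ord_max)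
     * F (ext_col c None) else 0) +
  (if P (Some true) && f ord_max then
     a * x * (\prod_i free_wt x (g i)) * F (ext_col [ffun=> None] (Some true)) else 0) +
  (if P (Some false) && f ord_max then
     \sum_(c | col_ok g c) col_wt a b x g c * b * F (ext_col c (Some false)) else 0).
Proof.
rewrite sum_column /=.
under eq_bigr do rewrite sum_option_bool !col_ok_ext !col_wt_ext !ext_col_max /=.
rewrite 2!big_split /=; congr (_ + _ + _).
- case: (P None); last by rewrite big1 // => c; rewrite andbF.
  rewrite [RHS]big_mkcond; apply: eq_bigr => c _; rewrite andbT; case: ifP => // _.
  by rewrite mul1r andbT.
- rewrite [P (Some true) && _]andbC; case: (f ord_max) => /=; last by rewrite big1.
  case: (P _); last by rewrite big1 // => c; rewrite andbF.
  rewrite (bigD1 [ffun=> None]) //= eqxx big1 ?addr0 => [|c /negbTE->] //=.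
  by rewrite col_wt_none /=; ring.
- rewrite [P (Some false) && _]andbC; case: (f ord_max) => /=; last by rewrite big1.
  case: (P _); last by rewrite big1 // => c; rewrite andbF.
  rewrite [RHS]big_mkcond; apply: eq_bigr => c _; rewrite andbT; case: ifP => // _.
  by rewrite mulr1.
Qed.

(* The factor [b] is the weight of a beta in the bottom box of the new column; it also
   clears the denominator of the geometric sum over the position of the alpha. *)
Lemma sum_col (R : comNzRingType) (a b x : R) n (f : pred 'I_n) :
  b * \sum_(c | col_ok f c) col_wt a b x f c =
  (a * x + b) * \prod_i free_wt (x + b) (f i) - a * x * \prod_i free_wt x (f i).
Proof.
elim: n f => [|n IH] f.
  rewrite !big_ord0 (bigD1 [ffun=> None]) ?big1 /=; first last.
  - by apply/col_okP; split=> -[].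
  - by move=> c /andP[_ /eqP[]]; apply/ffunP => -[].
  by rewrite /col_wt big_ord0; ring.
have := sum_col_ext a b x f predT (fun=> 1); rewrite /=.
under eq_bigl do rewrite andbT.
under eq_bigr do rewrite mulr1.
move=> ->; rewrite mulr1.
under eq_bigr do rewrite mulr1.
under [X in _ + (if _ then X else _)]eq_bigr do rewrite mulr1.
rewrite -!mulr_suml !big_ord_recr_lift /=.
have {IH} := IH (fun i => f (lift ord_max i)).
move: (\sum_(c | _) _) (\prod_i _) (\prod_i _) => U w v.
(* A free bottom row turns [U] into [(x + b) * U] plus [a * x] times the product of the [free_wt x];
   after multiplication by [b], this extra term corrects the factor [x + b] of the subtracted
   product to [x]. *)
case: (f ord_max) => /= IH; rewrite ?addr0 ?mulr1 //.
by rewrite !mulrDr !mulrA IH; ring.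
Qed.

(** Only one column survives: alpha in a free bottom row and nothing above. It creates no beta, so
    all free rows keep their factor [x]. *)
Lemma sum_col_last (R : comNzRingType) (a b x : R) n (f : pred 'I_n.+1) :
  \sum_(c | col_ok f c) col_wt a b x f c * (last_alpha c)%:R =
  a * (f ord_max)%:R * \prod_i free_wt x (f i).
Proof.
have := sum_col_ext a b x f predT (fun c => (last_alpha c)%:R); rewrite /=.
under eq_bigl do rewrite andbT.
move=> ->; rewrite ext_col_max eqxx.
rewrite big1 => [|c _]; last by rewrite ext_col_max mulr0.
rewrite [X in _ + (if _ then X else _)]big1 => [|c _]; last by rewrite ext_col_max mulr0.
rewrite big_ord_recr_lift /=.
by case: (f ord_max) => /=; ring.
Qed.

(** The diagonal box holds alpha with nothing above, or beta with any valid column above. Its row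
    stays free only in the first case. *)
Lemma sum_first_col (R : comNzRingType) (a b x : R) n (g : pred 'I_n)
    (F : column n.+1 -> R) :
  \sum_(c | col_ok (ext_pred g true) c && (c ord_max != None))
    col_wt a b x (ext_pred g true) c * F c =
  a * x * (\prod_i free_wt x (g i)) * F (ext_col [ffun=> None] (Some true)) +
  b * \sum_(c | col_ok g c) col_wt a b x g c * F (ext_col c (Some false)).
Proof.
rewrite (sum_col_ext a b x (ext_pred g true) [pred v | v != None]) /=.
have fg i : ext_pred g true (lift ord_max i) = g i by rewrite /ext_pred liftK.
have -> : ext_pred g true ord_max by rewrite /ext_pred unlift_none.
rewrite add0r mulr_sumr; congr (_ * _ * _ + _).
  by apply: eq_bigr => i _; rewrite fg.
apply: eq_big => c; first exact: eq_col_ok.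
by move=> _; rewrite (eq_col_wt a b x c fg); ring.
Qed.

Lemma sum_staircase_wt (R : realType) (a b x : R) n (F : filling n.+1 -> R) :
  \sum_(S | is_ab_staircase S) free_row_wt a b x S * F S =
  \sum_(T : filling n | is_ab_staircase T)
    (a * x * free_row_wt a b x T
       * F (ext_filling T (ext_col [ffun=> None] (Some true))) +
     wt a b T * (b * \sum_(c | col_ok (row_free T) c)
       col_wt a b x (row_free T) c * F (ext_filling T (ext_col c (Some false))))).
Proof.
rewrite sum_staircase; apply: eq_bigr => T _.
under eq_bigr do rewrite free_row_wt_ext -(mulrA (wt a b T)).
rewrite -mulr_sumr (sum_first_col a b x _ (fun c => F (ext_filling T c))).
by rewrite mulrDr /free_row_wt; congr (_ + _); ring.
Qed.

Lemma A_stat_ext_alpha n (T : filling n) :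
  A_stat (ext_filling T (ext_col [ffun=> None] (Some true))) = A_stat T.
Proof.
rewrite A_stat_ext; suff -> : @last_alpha n [ffun=> None] = false by rewrite addn0.
by case: n T => [//|n] T; rewrite /= ffunE.
Qed.

(** * Recursion for the binomial sums *)

Definition binomial_sum (R : realType) (a b : R) n k (x : R) : R :=
  \sum_(S : filling n | is_ab_staircase S) free_row_wt a b x S * 'C(A_stat S, k)%:R.

Lemma binomial_sum_n0 (R : realType) (a b : R) k x : binomial_sum a b 0 k x = (k == 0)%:R.
Proof.
have e (S S' : filling 0) : S = S' by apply/ffunP => -[[]].
rewrite /binomial_sum (bigD1 [ffun=> None]) ?big1 /=; first last.
- by apply/staircaseP; split; [case=> -[]|case|case|case=> -[]].
- by move=> S /andP[_ /eqP[]]; apply: e.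
rewrite addr0 /free_row_wt wtE A_statE !big_ord0 !mul1r.
by case: k.
Qed.

(** The bottom row has one staircase box, and it is filled, so the row is free exactly when this box
    holds alpha. The rest of the first column is then empty. *)
Lemma sum_bottom_alpha (R : realType) (a b : R) n k x :
  \sum_(S : filling n.+1 | is_ab_staircase S)
    free_row_wt a b x S * ('C(A_stat S, k)%:R * (row_free S ord_max)%:R) =
  a * x * binomial_sum a b n k x.
Proof.
rewrite sum_staircase_wt /binomial_sum mulr_sumr; apply: eq_bigr => T _.
rewrite [X in b * X]big1 => [|c _]; last first.
  by rewrite row_free_ext ext_col_max andbF !mulr0.
rewrite A_stat_ext_alpha row_free_ext ext_col_max /ext_pred unlift_none /=.
by ring.
Qed.

(** The tableaux with alpha in the bottom box cancel the subtracted product of [sum_col]. *)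
Lemma binomial_sum_k0 (R : realType) (a b : R) n x :
  binomial_sum a b n.+1 0 x = (a * x + b) * binomial_sum a b n 0 (x + b).
Proof.
rewrite /binomial_sum sum_staircase_wt mulr_sumr; apply: eq_bigr => T _.
under eq_bigr do rewrite bin0 mulr1.
by rewrite sum_col !bin0 /free_row_wt; ring.
Qed.

(** An alpha of the new column on the second diagonal raises [A_stat] by one; Pascal's rule then
    yields the extra sum. *)
Lemma binomial_sumS (R : realType) (a b : R) n k x :
  binomial_sum a b n.+1 k.+1 x = (a * x + b) * binomial_sum a b n k.+1 (x + b) +
  b * \sum_(T : filling n | is_ab_staircase T) wt a b T * 'C(A_stat T, k)%:R *
    \sum_(c | col_ok (row_free T) c) col_wt a b x (row_free T) c * (last_alpha c)%:R.
Proof.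
rewrite /binomial_sum sum_staircase_wt !mulr_sumr -big_split /=; apply: eq_bigr => T _.
have binE c : col_wt a b x (row_free T) c *
    'C(A_stat (ext_filling T (ext_col c (Some false))), k.+1)%:R =
  col_wt a b x (row_free T) c * 'C(A_stat T, k.+1)%:R +
  col_wt a b x (row_free T) c * (last_alpha c)%:R * 'C(A_stat T, k)%:R.
  rewrite A_stat_ext; case: (last_alpha c) => /=; first by rewrite addn1 binS natrD; ring.
  by rewrite addn0 mulr0 mul0r addr0.
under eq_bigr do rewrite binE.
rewrite big_split /= -!mulr_suml mulrDr [b * (_ * _)]mulrA sum_col A_stat_ext_alpha.
by rewrite /free_row_wt; ring.
Qed.

Lemma binomial_sum_1S (R : realType) (a b : R) k x : binomial_sum a b 1 k.+1 x = 0.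
Proof.
rewrite binomial_sumS binomial_sum_n0 mulr0 add0r big1 ?mulr0 // => T _.
by rewrite [X in _ * X]big1 ?mulr0 // => c _; rewrite mulr0.
Qed.

(* An alpha of the new column on the second diagonal forces a beta in the diagonal box
   below it and an alpha in the diagonal box to its right, whence the factor [a^2 b x]. *)
Lemma binomial_sumSS (R : realType) (a b : R) n k x :
  binomial_sum a b n.+2 k.+1 x = (a * x + b) * binomial_sum a b n.+1 k.+1 (x + b) +
  a ^+ 2 * b * x * binomial_sum a b n k x.
Proof.
rewrite binomial_sumS; congr (_ + _).
(* The innermost group is the sum over tableaux of size [n.+1] with a free bottom row, the condition
   left by [sum_col_last]. *)
have -> : a ^+ 2 * b * x * binomial_sum a b n k x =
  b * (a * (a * x * binomial_sum a b n k x)) by ring.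
rewrite -sum_bottom_alpha; congr (_ * _); rewrite mulr_sumr; apply: eq_bigr => T _.
by rewrite sum_col_last /free_row_wt; ring.
Qed.

(** For [a b] invertible, this is [(a b)^n] times the rising factorial of [(a x + b) / (a b)]. *)
Definition total_wt (R : comNzRingType) (a b : R) n (x : R) : R :=
  \prod_(i < n) (a * x + b + i%:R * (a * b)).

Lemma total_wtS (R : comNzRingType) (a b : R) n x :
  total_wt a b n.+1 x = (a * x + b) * total_wt a b n (x + b).
Proof.
rewrite /total_wt big_ord_recl mul0r addr0; congr (_ * _).
by apply: eq_bigr => i _; rewrite lift0 -natr1; ring.
Qed.

Lemma binomial_sum0E (R : realType) (a b : R) n x :
  binomial_sum a b n 0 x = total_wt a b n x.
Proof.
elim: n x => [|n IH] x; first by rewrite binomial_sum_n0 /total_wt big_ord0.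
by rewrite binomial_sum_k0 total_wtS IH.
Qed.

(** Lowering [k] by one in the recursion costs two in size, and sizes 0 and 1 give 0 for positive
    [k]. *)
Lemma binomial_sum_small (R : realType) (a b : R) n k x :
  (n < 2 * k)%N -> binomial_sum a b n k x = 0.
Proof.
elim/ltn_ind: n k x => -[|[|n]] IH [|k] x // lt.
- by rewrite binomial_sum_n0.
- exact: binomial_sum_1S.
- by rewrite binomial_sumSS !IH ?mulr0 ?addr0 //; lia.
Qed.

(** * Bounds for the binomial sums *)

Definition arith_sum (R : comNzRingType) (b : R) m (x : R) : R :=
  \sum_(i < m) (x + i%:R * b).

Lemma arith_sumS (R : comNzRingType) (b : R) m x :
  arith_sum b m.+1 x = x + arith_sum b m (x + b).
Proof.
rewrite /arith_sum big_ord_recl mul0r addr0; congr (_ + _).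
by apply: eq_bigr => i _; rewrite lift0 -natr1; ring.
Qed.

Lemma total_wt_ge0 (R : realType) (a b : R) n x :
  0 <= a -> 0 <= b -> 0 <= x -> 0 <= total_wt a b n x.
Proof.
by move=> a0 b0 x0; apply: prodr_ge0 => i _; rewrite !(addr_ge0, mulr_ge0).
Qed.

Lemma arith_sum_ge0 (R : realType) (b : R) n x :
  0 <= b -> 0 <= x -> 0 <= arith_sum b n x.
Proof. by move=> b0 x0; apply: sumr_ge0 => i _; rewrite addr_ge0 ?mulr_ge0. Qed.

(** The difference factors as [d] times a sum of [k + 1] products, each between [z^k] and
    [(z + d)^k]. *)
Lemma exprB_bounds (R : realDomainType) (z d : R) k : 0 <= z -> 0 <= d ->
  k.+1%:R * d * z ^+ k <= (z + d) ^+ k.+1 - z ^+ k.+1 <= k.+1%:R * d * (z + d) ^+ k.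
Proof.
move=> z0 d0; rewrite subrXX addrAC subrr add0r.
have zd : z <= z + d by rewrite lerDl.
have zd0 : 0 <= z + d by rewrite addr_ge0.
rewrite -!mulrA ![k.+1%:R * _]mulrCA !ler_wpM2l //.
  rewrite [leRHS]mulr_natl -[X in _ *+ X]card_ord -sumr_const; apply: ler_sum => i _.
  rewrite -[in leRHS](subnK (leq_ord i)) exprD.
  by rewrite ler_wpM2l ?exprn_ge0 // lerXn2r ?nnegrE.
rewrite mulr_natl -[X in _ *+ X]card_ord -sumr_const; apply: ler_sum => i _.
rewrite -[in leLHS](subnK (leq_ord i)) exprD.
by rewrite ler_wpM2r ?exprn_ge0 // lerXn2r ?nnegrE.
Qed.

(** Complete homogeneous polynomials satisfy [h_(k+1)(x, Y) = h_(k+1)(Y) + x h_k(x, Y)]. With [T]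
    the sum of the variables [Y], the two inequalities carry the bounds [T^k / k!] and
    [(T + k M)^k / k!] through this recursion. *)
Lemma divided_power_bounds (R : realFieldType) (x T M : R) k :
  0 <= x -> x <= M -> 0 <= T ->
  (x + T) ^+ k.+1 / k.+1`!%:R
    <= T ^+ k.+1 / k.+1`!%:R + x * ((x + T) ^+ k / k`!%:R) /\
  (T + k.+1%:R * M) ^+ k.+1 / k.+1`!%:R + x * ((x + T + k%:R * M) ^+ k / k`!%:R)
    <= (x + T + k.+1%:R * M) ^+ k.+1 / k.+1`!%:R.
Proof.
move=> x0 xM T0.
have M0 : 0 <= M by apply: le_trans xM.
have kf0 : k`!%:R != 0 :> R by rewrite pnatr_eq0 -lt0n fact_gt0.
have fS z : x * (z / k`!%:R) = k.+1%:R * x * z / k.+1`!%:R.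
  by rewrite factS natrM; field; rewrite kf0 nat1r pnatr_eq0.
rewrite !fS -!mulrDl !ler_pM2r ?invr_gt0 ?ltr0n ?fact_gt0 //; split.
  by have /andP[_] := exprB_bounds k T0 x0; rewrite [T + x]addrC lerBlDl.
have z0 : 0 <= T + k.+1%:R * M by rewrite addr_ge0 ?mulr_ge0.
have /andP[+ _] := exprB_bounds k z0 x0; rewrite lerBrDl.
have -> : T + k.+1%:R * M + x = x + T + k.+1%:R * M by ring.
apply: le_trans; rewrite lerD2l ler_wpM2l ?mulr_ge0 // lerXn2r ?nnegrE //.
  by rewrite !addr_ge0 ?mulr_ge0.
by rewrite -natr1; nra.
Qed.

(* The binomial sum equals [C] times the complete homogeneous symmetric polynomial of
   degree [k] in [x, x + b, ..., x + m b]; [M] bounds these variables. *)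
Lemma binomial_sum_bounds (R : realType) (a b : R) m k x M :
  0 <= a -> 0 <= b -> 0 <= x -> x + m.+1%:R * b <= M ->
  let C := (a ^+ 2 * b) ^+ k * total_wt a b m x in
  C * (arith_sum b m.+1 x ^+ k / k`!%:R) <= binomial_sum a b (m + 2 * k) k x
    <= C * ((arith_sum b m.+1 x + k%:R * M) ^+ k / k`!%:R).
Proof.
move=> a0 b0; elim: k m x M => [|k IHk] m x M x0 xM /=.
  by rewrite !expr0 fact0 invr1 muln0 addn0 binomial_sum0E !mulr1 mul1r lexx.
have D0 : 0 <= a ^+ 2 * b by rewrite mulr_ge0 ?exprn_ge0.
have xleM : x <= M by apply: le_trans xM; rewrite lerDl mulr_ge0.
have M0 : 0 <= M by apply: le_trans xleM.
elim: m x x0 xM xleM => [|m IHm] x x0 xM xleM.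
  have -> : (0 + 2 * k.+1)%N = (0 + 2 * k).+2 by lia.
  (* Size [2k + 1] is too small for [k + 1], so only the second term of the recursion remains. *)
  rewrite binomial_sumSS binomial_sum_small ?mulr0 ?add0r; last by lia.
  have /andP[] := IHk _ _ _ x0 xM.
  rewrite /arith_sum /total_wt big_ord1 big_ord0 mul0r addr0.
  have [] := divided_power_bounds k x0 xleM (lexx 0).
  have V0 : 0 <= (0 + k.+1%:R * M) ^+ k.+1 / k.+1`!%:R :> R.
    by rewrite divr_ge0 // exprn_ge0 // addr_ge0 ?mulr_ge0.
  move: V0; rewrite addr0 [0 ^+ _]expr0n mul0r.
  move: (binomial_sum _ _ _ _ _) => B.
  set P := x ^+ k.+1 / _; set V := (0 + _) ^+ k.+1 / _; set P' := x ^+ k / _.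
  set U := (x + _) ^+ k.+1 / _; set U' := _ / k`!%:R => V0 h1 h2 l u.
  have h1' := ler_wpM2l (exprn_ge0 k.+1 D0) h1.
  have h2' := ler_wpM2l (exprn_ge0 k.+1 D0) h2.
  have V0' := mulr_ge0 (exprn_ge0 k.+1 D0) V0.
  have := ler_wpM2l (mulr_ge0 D0 x0) l; have := ler_wpM2l (mulr_ge0 D0 x0) u.
  move: h1' h2' V0'; rewrite exprS => *; apply/andP; split; nra.
have -> : (m.+1 + 2 * k.+1)%N = (m.+1 + 2 * k).+2 by lia.
rewrite binomial_sumSS.
(* The first term falls under [IHm] at [x + b], the second under [IHk] at [m.+1] and [x]; the same
   [M] serves both. *)
have -> : (m.+1 + 2 * k).+1 = (m + 2 * k.+1)%N by lia.
have xb0 := addr_ge0 x0 b0.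
have xbM : x + b + m.+1%:R * b <= M.
  by apply: le_trans xM; rewrite -[m.+2%:R]natr1; lra.
have xbM' : x + b <= M by apply: le_trans xbM; rewrite lerDl mulr_ge0.
have /andP[] := IHm _ xb0 xbM xbM'.
have /andP[/=] := IHk _ _ _ x0 xM.
rewrite total_wtS [arith_sum b m.+2 x]arith_sumS.
have T0 : 0 <= arith_sum b m.+1 (x + b) by apply: arith_sum_ge0.
have [] := divided_power_bounds k x0 xleM T0.
have : 0 <= total_wt a b m (x + b) by apply: total_wt_ge0.
move: (total_wt _ _ _ _) (arith_sum _ _ _) (binomial_sum _ _ _ _ _) (binomial_sum _ _ _ _ _).
move=> W T B B' W0.
set P := (x + T) ^+ k.+1 / _; set Q := T ^+ k.+1 / _; set P' := (x + T) ^+ k / _.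
set U := (x + T + _) ^+ k.+1 / _; set V := (T + _) ^+ k.+1 / _; set U' := _ / k`!%:R.
move=> h1 h2 l u l' u'.
have A0 : 0 <= a * x + b by rewrite addr_ge0 ?mulr_ge0.
have h1' := ler_wpM2l (mulr_ge0 (mulr_ge0 (exprn_ge0 k.+1 D0) A0) W0) h1.
have h2' := ler_wpM2l (mulr_ge0 (mulr_ge0 (exprn_ge0 k.+1 D0) A0) W0) h2.
have := ler_wpM2l A0 l'; have := ler_wpM2l A0 u'.
have := ler_wpM2l (mulr_ge0 D0 x0) l; have := ler_wpM2l (mulr_ge0 D0 x0) u.
move: h1' h2'; rewrite exprS => *; apply/andP; split; nra.
Qed.

(** * Limits of the binomial moments *)

Lemma total_wtD (R : realType) (a b : R) m p x :
  total_wt a b (m + p) x =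
  total_wt a b m x * \prod_(i < p) (a * x + b + (m + i)%:R * (a * b)).
Proof. by rewrite /total_wt big_split_ord. Qed.

Lemma total_wt_gt0 (R : realType) (a b : R) n x :
  0 < a -> 0 < b -> 0 <= x -> 0 < total_wt a b n x.
Proof.
by move=> a0 b0 x0; apply: prodr_gt0 => i _; rewrite ltr_wpDr ?ltr_wpDl ?mulr_ge0 // ltW.
Qed.

Lemma arith_sumE (R : realType) (b : R) m x :
  arith_sum b m.+1 x = m.+1%:R * (x + m%:R * b / 2).
Proof.
elim: m x => [|m IH] x; first by rewrite /arith_sum big_ord1 !mul0r addr0 mul1r.
by rewrite arith_sumS IH -[m.+2%:R]natr1 -[m.+1%:R]natr1; field.
Qed.

Lemma cvg_affine_harmonic (R : realType) (c d : R) :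
  (fun m => c + d * harmonic m) @ \oo --> c.
Proof.
rewrite -[X in _ --> X]addr0 -(mulr0 d).
by apply: cvgD; [exact: cvg_cst | apply: cvgMl_tmp; exact: cvg_harmonic].
Qed.

Lemma cvg_prod_ord (R : realType) K (u : 'I_K -> nat -> R) (l : R) :
  (forall i, u i @ \oo --> l) -> (fun m => \prod_(i < K) u i m) @ \oo --> l ^+ K.
Proof.
elim: K u => [|K IH] u hu.
  by rewrite expr0; under eq_fun do rewrite big_ord0; exact: cvg_cst.
under eq_fun do rewrite big_ord_recr /=.
by rewrite exprSr; apply: cvgM; [apply: IH => i|]; apply: hu.
Qed.

Lemma cvg_binomial_ratio (R : realType) (a b : R) k : 0 < a -> 0 < b ->
  (fun n => binomial_sum a b n k 1 / total_wt a b n 1) @ \oo -->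
    ((1 / 2) ^+ k / k`!%:R : R).
Proof.
move=> a0 b0; rewrite -(cvg_shiftn (2 * k)).
(* At size [m + 2k], all is divided by [(m + 1)^(2k)] and written in [harmonic m = 1 / (m + 1)]:
   [den] comes from the last [2k] factors of the total weight, [lo] and [up] from the two bounds. *)
pose den (m : nat) : R :=
  \prod_(i < 2 * k) (a * b + (a + b + (i%:R - 1) * (a * b)) * harmonic m).
pose lo m : R := \prod_(i < k) (a ^+ 2 * b * (b / 2 + (1 - b / 2) * harmonic m)).
pose up m : R := \prod_(i < k) (a ^+ 2 * b *
  (b / 2 + (1 - b / 2 + k%:R * b) * harmonic m + k%:R * harmonic m * harmonic m)).
have cden : den @ \oo --> (a * b) ^+ (2 * k).
  by apply: cvg_prod_ord => i; apply: cvg_affine_harmonic.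
have clo : lo @ \oo --> (a ^+ 2 * b * (b / 2)) ^+ k.
  by apply: cvg_prod_ord => _; apply: cvgMl_tmp; apply: cvg_affine_harmonic.
have cup : up @ \oo --> (a ^+ 2 * b * (b / 2)) ^+ k.
  apply: cvg_prod_ord => _; apply: cvgMl_tmp; rewrite -[X in _ --> X]addr0.
  apply: cvgD; first exact: cvg_affine_harmonic.
  rewrite -[X in _ --> X](mulr0 (k%:R * 0)).
  by apply: cvgM; [apply: cvgMl_tmp|]; exact: cvg_harmonic.
have ab0 : a * b != 0 by rewrite mulf_neq0 ?gt_eqF.
have lim : (1 / 2) ^+ k / k`!%:R =
    (a ^+ 2 * b * (b / 2)) ^+ k / k`!%:R / (a * b) ^+ (2 * k) :> R.
  rewrite mulrAC exprM -expr_div_n; congr (_ ^+ k / _); field.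
  by rewrite !gt_eqF.
rewrite lim.
apply: (@squeeze_cvgr _ _ _ _ (fun m => lo m / k`!%:R / den m)
  (fun m => up m / k`!%:R / den m)); last first.
- by apply: cvgM; [apply: cvgMr_tmp|apply: cvgV; rewrite ?expf_neq0].
- by apply: cvgM; [apply: cvgMr_tmp|apply: cvgV; rewrite ?expf_neq0].
near=> m.
have N0 : m.+1%:R != 0 :> R by rewrite pnatr_eq0.
have P0 := total_wt_gt0 m a0 b0 ler01.
(* The least admissible [M] is of order [m], negligible against [arith_sum], of order [m^2]. *)
have x1 : 1 + m.+1%:R * b <= 1 + m.+1%:R * b by [].
have := binomial_sum_bounds k (ltW a0) (ltW b0) ler01 x1.
set Q := \prod_(i < 2 * k) (a * 1 + b + (m + i)%:R * (a * b)) : R.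
have Q0 : 0 < Q.
  apply: prodr_gt0 => i _; rewrite mulr1 ltr_wpDr ?addr_gt0 //.
  by rewrite mulr_ge0 // mulr_ge0 ?ltW.
have denE : den m = Q / m.+1%:R ^+ (2 * k).
  rewrite -[X in _ ^+ X](card_ord (2 * k)) -prodr_const -prodf_div.
  by apply: eq_bigr => i _; rewrite /harmonic /= natrD -natr1; field; rewrite ?natr1 ?nat1r.
have loE : lo m = (a ^+ 2 * b * arith_sum b m.+1 1) ^+ k / m.+1%:R ^+ (2 * k).
  rewrite exprM -expr_div_n -[X in _ ^+ X](card_ord k) -prodr_const.
  apply: eq_bigr => i _; rewrite /harmonic /= arith_sumE -natr1; field.
  by rewrite ?natr1 ?nat1r.
have upE : up m = (a ^+ 2 * b * (arith_sum b m.+1 1 + k%:R * (1 + m.+1%:R * b))) ^+ k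
    / m.+1%:R ^+ (2 * k).
  rewrite exprM -expr_div_n -[X in _ ^+ X](card_ord k) -prodr_const.
  apply: eq_bigr => i _; rewrite /harmonic /= arith_sumE -natr1; field.
  by rewrite ?natr1 ?nat1r.
have cancel z : z / m.+1%:R ^+ (2 * k) / k`!%:R / den m = z / k`!%:R / Q.
  rewrite denE; field; rewrite gt_eqF //= pnatr_eq0 -lt0n fact_gt0 /=.
  by rewrite expf_neq0 // nat1r.
rewrite loE upE !cancel /= total_wtD -/Q invfM.
move=> /andP[l u]; rewrite [X in _ <= X <= _]mulrA !ler_pM2r ?invr_gt0 //.
rewrite ler_pdivlMr // ler_pdivrMr // ![(a ^+ 2 * b * _) ^+ k]exprMn.
move: ((a ^+ 2 * b) ^+ k) (_ ^+ k) l ((_ + _) ^+ k) u => D P l P' u; apply/andP; split.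
  by apply: le_trans l; rewrite le_eqVlt; apply/orP; left; apply/eqP; ring.
by apply: le_trans u _; rewrite le_eqVlt; apply/orP; left; apply/eqP; ring.
Unshelve. all: by end_near.
Qed.

(** * Bonferroni inequalities *)

(** For positive [N] and [K] the alternating sum telescopes to a signed [C(N - 1, K - 1)], at most
    [C(N, K)]. *)
Lemma sum_signed_bin (R : realDomainType) N K :
  `| (N == 0%N)%:R - \sum_(j < K) (-1) ^+ j * 'C(N, j)%:R | <= 'C(N, K)%:R :> R.
Proof.
case: N => [|N].
  case: K => [|K]; first by rewrite big_ord0 subr0 normr1 bin0.
  rewrite big_ord_recl big1 => [|i _]; last by rewrite bin_small ?mulr0.
  by rewrite bin0 mulr1 addr0 subrr normr0.
rewrite sub0r normrN; case: K => [|K]; first by rewrite big_ord0 normr0.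
have -> : \sum_(j < K.+1) (-1) ^+ j * 'C(N.+1, j)%:R = (-1) ^+ K * 'C(N, K)%:R :> R.
  elim: K => [|K IH]; first by rewrite big_ord1 !bin0.
  by rewrite big_ord_recr /= IH binS natrD exprS; ring.
by rewrite normrM normrX normrN1 expr1n mul1r normr_nat ler_nat binS leq_addl.
Qed.

(** Both sides count the [k]-subsets inside [(k + j)]-subsets of a set of [k + N] elements. *)
Lemma bin_mul_bin k j N : ('C(k + j, k) * 'C(k + N, k + j) = 'C(k + N, k) * 'C(N, j))%N.
Proof.
have [ltNj|lejN] := ltnP N j.
  by rewrite ['C(k + N, k + j)]bin_small ?ltn_add2l // ['C(N, j)]bin_small // !muln0.
rewrite -(subnKC lejN); move: (N - j)%N => r.
have e1 := bin_fact (leq_addr j k).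
have e2 : ('C(k + (j + r), k + j) * ((k + j)`! * r`!) = (k + (j + r))`!)%N.
  by have := @bin_fact (k + (j + r)) (k + j); rewrite addnA addKn leq_addr; apply.
have e3 := bin_fact (leq_addr (j + r) k).
have e4 := bin_fact (leq_addr r j).
rewrite !addKn in e1 e3 e4; rewrite -e1 -e3 -e4 in e2.
have f0 : (0 < k`! * (j`! * r`!))%N by rewrite !muln_gt0 !fact_gt0.
by apply/eqP; rewrite -(eqn_pmul2r f0); apply/eqP; lia.
Qed.

(** For [A = k + N] the factor [C(k + N, k)] comes out of every term, leaving [sum_signed_bin] for
    [N]. *)
Lemma bonferroni (R : realDomainType) A k K :
  `| (A == k)%:R - \sum_(j < K) (-1) ^+ j * 'C(k + j, k)%:R * 'C(A, k + j)%:R |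
    <= 'C(k + K, k)%:R * 'C(A, k + K)%:R :> R.
Proof.
have [ltAk|leAk] := ltnP A k.
  rewrite big1 => [|j _]; last by rewrite ['C(A, _)]bin_small ?mulr0 ?ltn_addr.
  by rewrite ltn_eqF // subr0 normr0 mulr_ge0.
rewrite -(subnKC leAk); move: (A - k)%N => N.
have binM j : 'C(k + j, k)%:R * 'C(k + N, k + j)%:R = 'C(k + N, k)%:R * 'C(N, j)%:R :> R.
  by rewrite -!natrM bin_mul_bin.
under eq_bigr do rewrite -mulrA binM mulrCA.
rewrite -mulr_sumr binM.
have -> : ((k + N)%N == k)%:R = 'C(k + N, k)%:R * (N == 0%N)%:R :> R.
  by rewrite -[X in _ == X]addn0 eqn_add2l; case: N {binM} => [|N]; rewrite ?addn0 ?binn ?mulr1 ?mulr0.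
by rewrite -mulrBr normrM normr_nat ler_wpM2l // sum_signed_bin.
Qed.

Lemma free_row_wt1 (R : realType) (a b : R) n (S : filling n) : free_row_wt a b 1 S = wt a b S.
Proof. by rewrite /free_row_wt big1 ?mulr1 // => i _; rewrite /free_wt if_same. Qed.

(** The pointwise inequality averaged over tableaux; at [x = 1] the row marking disappears. *)
Lemma prob_A_bonferroni (R : realType) (a b : R) n k K : 0 < a -> 0 < b ->
  `| prob_A_eq a b n k - \sum_(j < K) (-1) ^+ j * 'C(k + j, k)%:R *
       (binomial_sum a b n (k + j) 1 / total_wt a b n 1) |
  <= 'C(k + K, k)%:R * (binomial_sum a b n (k + K) 1 / total_wt a b n 1).
Proof.
move=> a0 b0; have Z0 := total_wt_gt0 n a0 b0 ler01.
have -> : prob_A_eq a b n k =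
    (\sum_(S : filling n | is_ab_staircase S) wt a b S * (A_stat S == k)%:R)
      / total_wt a b n 1.
  rewrite /prob_A_eq -binomial_sum0E; congr (_ / _).
    by rewrite big_mkcondr; apply: eq_bigr => S _; case: eqP; rewrite ?mulr1 ?mulr0.
  by apply: eq_bigr => S _; rewrite free_row_wt1 bin0 mulr1.
under [X in _ - X]eq_bigr do rewrite mulrA.
rewrite -[X in _ - X]mulr_suml -mulrBl normrM [`|_^-1|]gtr0_norm ?invr_gt0 // mulrA ler_pM2r ?invr_gt0 //.
rewrite /binomial_sum; under [X in _ - X]eq_bigr do rewrite mulr_sumr.
rewrite [X in _ - X]exchange_big mulr_sumr -sumrB.
apply: le_trans (ler_norm_sum _ _ _) _; apply: ler_sum => S _.
under eq_bigr do rewrite free_row_wt1 mulrCA.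
rewrite -mulr_sumr -mulrBr free_row_wt1 mulrCA normrM.
have w0 : 0 <= wt a b S by rewrite mulr_ge0 // exprn_ge0 // ltW.
by rewrite ger0_norm // ler_wpM2l // bonferroni.
Qed.

(** * Passage to the Poisson law *)

Lemma cvg_iterated_approx (R : realType) (p : nat -> R) (s e : nat -> nat -> R)
    (S E : nat -> R) (l : R) :
  (forall n K, `|p n - s K n| <= e K n) ->
  (forall K, s K @ \oo --> S K) -> (forall K, e K @ \oo --> E K) ->
  S @ \oo --> l -> E @ \oo --> 0 -> p @ \oo --> l.
Proof.
move=> h cs ce /cvgrPdist_le cS /cvgrPdist_le cE; apply/cvgrPdist_le => eps eps0.
(* Four errors add up: [l - S K], [S K - s K n], [E K], and [e K n - E K]. [K] is fixed before [n]
   grows. *)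
have eps4 : 0 < eps / 4 by rewrite divr_gt0.
have [K [hS hE]] : exists K, `|l - S K| <= eps / 4 /\ `|0 - E K| <= eps / 4.
  have [K1 _ h1] := cS _ eps4; have [K2 _ h2] := cE _ eps4.
  exists (maxn K1 K2); split; [apply: h1 | apply: h2]; rewrite /= ?leq_maxl ?leq_maxr //.
have /cvgrPdist_le/(_ _ eps4) cs' := cs K.
have /cvgrPdist_le/(_ _ eps4) ce' := ce K.
near=> n.
have hs : `|S K - s K n| <= eps / 4 by near: n.
have he : `|E K - e K n| <= eps / 4 by near: n.
have := h n K; rewrite !ler_norml in hS hE hs he *.
by move=> /andP[? ?]; move/andP: hS => [? ?]; move/andP: hE => [? ?];
  move/andP: hs => [? ?]; move/andP: he => [? ?]; apply/andP; split; lra.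
Unshelve. all: by end_near.
Qed.

(** Pulls [x^k / k!] out of the limiting moments, so that their alternating sum is a partial sum of
    the series of [exp (- x)]. *)
Lemma bin_poisson (R : realType) (x : R) k j :
  'C(k + j, k)%:R * (x ^+ (k + j) / (k + j)`!%:R) = x ^+ k / k`!%:R * exp_coeff x j.
Proof.
have f0 m : m`!%:R != 0 :> R by rewrite pnatr_eq0 -lt0n fact_gt0.
rewrite -[in (k + j)`!](bin_fact (leq_addr j k)) addKn !natrM exprD /exp_coeff /=.
by field; rewrite !f0 pnatr_eq0 -lt0n bin_gt0 leq_addr.
Qed.

(** All laws live on the natural numbers, so convergence of each point probability is convergence in
    distribution. *)
Theorem theorem3p5 (R : realType) (alpha beta : R) (halpha : 0 < alpha) (hbeta : 0 < beta) :
  forall k : nat,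
    (fun n : nat => prob_A_eq alpha beta n k) @ \oo --> poisson_pmf (1 / 2 : R) k.
Proof.
move=> k.
pose x : R := 1 / 2.
pose mu n j := binomial_sum alpha beta n j 1 / total_wt alpha beta n 1.
have cmu j : mu^~ j @ \oo --> x ^+ j / j`!%:R by apply: cvg_binomial_ratio.
apply: (@cvg_iterated_approx _ _
  (fun K n => \sum_(j < K) (-1) ^+ j * 'C(k + j, k)%:R * mu n (k + j)%N)
  (fun K n => 'C(k + K, k)%:R * mu n (k + K)%N)
  (fun K => \sum_(j < K) (-1) ^+ j * 'C(k + j, k)%:R * (x ^+ (k + j) / (k + j)`!%:R))
  (fun K => 'C(k + K, k)%:R * (x ^+ (k + K) / (k + K)`!%:R))).
- by move=> n K; apply: prob_A_bonferroni.
- move=> K; elim: K => [|K IH].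
    by rewrite big_ord0; under eq_fun do rewrite big_ord0; exact: cvg_cst.
  rewrite big_ord_recr /=; under eq_fun do rewrite big_ord_recr /=.
  by apply: cvgD => //; apply: cvgMl_tmp.
- by move=> K; apply: cvgMl_tmp.
- have -> : (fun K => \sum_(j < K) (-1) ^+ j * 'C(k + j, k)%:R *
      (x ^+ (k + j) / (k + j)`!%:R)) =
      (fun K => x ^+ k / k`!%:R * series (exp_coeff (- x)) K).
    apply/funext => K; rewrite /series /= big_mkord mulr_sumr; apply: eq_bigr => j _.
    rewrite -mulrA bin_poisson mulrCA /exp_coeff /=; congr (_ * _).
    by rewrite [(- x) ^+ j]exprNn mulrA.
  (* [poisson_pmf] is defined by cases on the sign of its rate; positivity of [1 / 2] selects the
     Poisson formula. *)
  rewrite /poisson_pmf divr_gt0 //; apply: cvgMl_tmp.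
  exact: is_cvg_series_exp_coeff.
(* The error bounds are multiples of the terms of the convergent series of [exp x], so they
   vanish. *)
- under eq_fun do rewrite bin_poisson.
  rewrite -(mulr0 (x ^+ k / k`!%:R)); apply: cvgMl_tmp.
  by apply: cvg_series_cvg_0; apply: is_cvg_series_exp_coeff.
Qed.
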